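(* Let $(\lambda_N)_{N\ge 1}$ be a sequence of probability measures on $\mathbb{R}$ that converges weakly to a probability measure $\lambda$ on $\mathbb{R}$ and satisfies the large deviation principle with a convex rate function $\mathcal{I}$. On a common probability space, for every $N\ge 1$ let $\xi_i=\xi_i^{(N)}$, $1\le i\le 2^N$, be i.i.d. random variables with distribution $\lambda_N$, and for each $\omega$ let $$\mu_N(\omega)=\frac{1}{2^N}\sum_{i=1}^{2^N}\delta_{\xi_i^{(N)}(\omega)}$$ be the empirical measure. Then for almost every $\omega$ the sequence $\{\mu_N(\omega)\}_{N\ge 1}$ satisfies the large deviation principle with rate function $\mathcal{J}$ given by $$\mathcal{J}(x)=\begin{cases}\mathcal{I}(x) & \text{if } \mathcal{I}(x)\le \log 2,\\ \infty & \text{if } \mathcal{I}(x)>\log 2.\end{cases}$$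
   Context: A rate function on a topological space $X$ is a lower semicontinuous map $X\to[0,\infty]$ (its level sets need not be compact). A sequence of probability measures $(\nu_N)$ on $X$ (with its Borel $\sigma$-algebra) satisfies the large deviation principle (LDP) with rate function $\mathcal{R}$ if, with speed $N$, $\limsup_{N\to\infty}\frac1N\log\nu_N(F)\le-\inf_{x\in F}\mathcal{R}(x)$ for every closed $F\subseteq X$ and $\liminf_{N\to\infty}\frac1N\log\nu_N(G)\ge-\inf_{x\in G}\mathcal{R}(x)$ for every open $G\subseteq X$. Here $\delta_x$ is the point mass at $x$. No relation is assumed between the random variables for different values of $N$ beyond being defined on a common probability space. *)

(* Defs.v *)
From HB Require Import structures.
From mathcomp Require Import all_boot all_order all_algebra.
From mathcomp Require Import all_classical all_reals all_analysis.

Set Implicit Arguments.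
Unset Strict Implicit.
Unset Printing Implicit Defensive.

Import Order.TTheory GRing.Theory Num.Theory.
Import numFieldNormedType.Exports.

Local Open Scope classical_set_scope.
Local Open Scope ring_scope.
Local Open Scope ereal_scope.

(* Level sets are not required to be compact. *)
Definition rate_function (R : realType) (X : topologicalType)
    (I : X -> \bar R) : Prop :=
  (forall x, 0 <= I x) /\ lower_semicontinuous I.

(* Convexity for functions with values in [0, +oo]; the library convention
   0 * +oo = 0 makes the cases t = 0 and t = 1 trivially true. *)
Definition convex_efunction (R : realType) (I : R -> \bar R) : Prop :=
  forall (x y t : R), (0 <= t <= 1)%R ->
    I (t * x + (1 - t) * y)%R <= t%:E * I x + (1 - t)%:E * I y.

(* [lne 0 = -oo] and [ereal_inf set0 = +oo]. The term of index 0 is irrelevant,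
   as it does not affect the upper and lower limits. *)
Definition large_deviation_principle (R : realType)
    (nu : nat -> probability R R) (I : R -> \bar R) : Prop :=
  [/\ rate_function I,
      forall F : set R, closed F ->
        limn_esup (fun N => (N%:R^-1)%:E * lne (nu N F))
          <= - ereal_inf (I @` F)
    & forall G : set R, open G ->
        - ereal_inf (I @` G)
          <= limn_einf (fun N => (N%:R^-1)%:E * lne (nu N G))].

Definition weak_convergence (R : realType)
    (nu : nat -> probability R R) (mu : probability R R) : Prop :=
  forall f : R -> R, continuous f -> [bounded f x | x in [set: R]] ->
    \int[nu N]_x (f x)%:E @[N --> \oo] --> \int[mu]_x (f x)%:E.

Definition mutually_independent (R : realType) (d : measure_display)
    (Omega : measurableType d) (P : probability Omega R) (I : finType)
    (X : I -> {RV P >-> R}) : Prop :=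
  forall (J : {set I}) (A : I -> set R), (forall i, measurable (A i)) ->
    P (\bigcap_(i in [set` J]) (X i @^-1` A i))
      = \prod_(i in J) P (X i @^-1` A i).

Definition iid (R : realType) (d : measure_display)
    (Omega : measurableType d) (P : probability Omega R) (I : finType)
    (X : I -> {RV P >-> R}) (mu : probability R R) : Prop :=
  mutually_independent X /\
  forall (i : I) (A : set R), measurable A -> distribution P (X i) A = mu A.

Definition empirical_measure (R : realType) (N : nat) (x : 'I_(2 ^ N) -> R)
    (A : set R) : \bar R :=
  ((2 ^+ N)^-1)%:E * \sum_(i < 2 ^ N) \d_(x i) A.

Section empirical_measure_probability.
Context (R : realType) (N : nat) (x : 'I_(2 ^ N) -> R).

Let pt (k : nat) : R := if insub k is Some i then x i else 0%R.

Let weight_ge0 : (0 <= (2 ^+ N)^-1 :> R)%R.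
Proof. by rewrite invr_ge0 exprn_ge0. Qed.

Let mu : {measure set R -> \bar R} :=
  mscale (NngNum weight_ge0)
    (msum (fun k => \d_(pt k) : {measure set R -> \bar R}) (2 ^ N)).

Let empirical_measureE A : empirical_measure x A = mu A.
Proof.
rewrite /empirical_measure /mu /mscale /= /msum; congr (_ * _).
by apply: eq_bigr => i _; rewrite /pt valK.
Qed.

Let empirical_measure0 : empirical_measure x set0 = 0.
Proof. by rewrite empirical_measureE measure0. Qed.

Let empirical_measure_ge0 A : 0 <= empirical_measure x A.
Proof. by rewrite empirical_measureE measure_ge0. Qed.

Let empirical_measure_semi_sigma_additive :
  semi_sigma_additive (empirical_measure x).
Proof.
rewrite (funext empirical_measureE : empirical_measure x = mu).
exact: measure_semi_sigma_additive.
Qed.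

HB.instance Definition _ := isMeasure.Build _ _ _ (empirical_measure x)
  empirical_measure0 empirical_measure_ge0
  empirical_measure_semi_sigma_additive.

Let empirical_measure_setT : empirical_measure x [set: R] = 1.
Proof.
rewrite /empirical_measure (eq_bigr (fun=> 1%:E)); last first.
  by move=> i _; rewrite diracT.
rewrite sumEFin -EFinM sumr_const card_ord natrX mulVf//.
Qed.

HB.instance Definition _ := Measure_isProbability.Build _ _ _
  (empirical_measure x) empirical_measure_setT.

End empirical_measure_probability.

(* Main.v *)
Require Import Defs.
From HB Require Import structures.
From mathcomp Require Import all_boot all_order all_algebra.
From mathcomp Require Import all_classical all_reals all_analysis.
From mathcomp Require Import measurable_realfun ring lra.

(** Write n = 2 ^ N. The number of sample points in a Borel set A is binomial
with mean n * lam_N(A), and the large deviation principle for lam_N says that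
this mean has exponential order exp(N (ln 2 - i)), where i stands for the
infimum of the rate function I over A. When i > ln 2 the mean decays
geometrically, so by Markov's inequality and Borel-Cantelli the set A is
eventually empty of sample points: this is why the rate is truncated at ln 2.
When i < ln 2 the mean grows geometrically; the variance is at most the mean,
so Chebyshev's inequality and Borel-Cantelli show that the empirical measure is
eventually at least half of lam_N(A). The upper bound needs only first moments
([ae_empirical_decay]), the lower bound only second moments
([ae_empirical_growth]).

Those statements hold almost surely for one fixed set and one fixed exponent,
whereas the principle speaks of all closed and all open sets simultaneously, so
a reduction to countably many sets is needed. Weak convergence makes lam_N
tight, which forces the lower semicontinuous function I to vanish at some x0
([rate_function_has_zero]); by convexity I is then monotone on each side of x0.
Hence a closed set avoiding x0 lies inside two half-lines with rational
endpoints, on which the infimum of the truncated rate is almost as large as on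
the closed set itself ([closed_left_cover], [closed_right_cover]): half-lines
with rational endpoints suffice for the upper bound ([empirical_upper_bound]).
For the lower bound, rational open intervals suffice to localise at a point
where I < ln 2 ([empirical_lower_bound]). The critical level I = ln 2, where
the mean number of points has no definite growth, is handled by convexity
again: such a point is a limit of points on the segment towards x0, where I is
smaller than ln 2 ([exists_subcritical]). *)

Set Implicit Arguments.
Unset Strict Implicit.
Unset Printing Implicit Defensive.

Import Order.TTheory GRing.Theory Num.Theory.
Import numFieldNormedType.Exports.

Local Open Scope classical_set_scope.
Local Open Scope ring_scope.
Local Open Scope ereal_scope.

(** * Upper and lower limits on the exponential scale *)

Lemma limn_esup_le_near (R : realType) (u : nat -> \bar R) (l : \bar R) :
  (\forall n \near \oo, u n <= l) -> limn_esup u <= l.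
Proof.
move=> ul; apply: (@le_trans _ _ (ereal_sup (u @` [set n | u n <= l]))).
  by apply: ereal_inf_lbound; exists [set n | u n <= l].
by apply: ge_ereal_sup => _ [n /= + <-].
Qed.

Lemma limn_esup_lt_near (R : realType) (u : nat -> \bar R) (l : \bar R) :
  limn_esup u < l -> \forall n \near \oo, u n < l.
Proof.
move=> /ereal_inf_lt[_ [V Voo <-] Vl].
apply: filterS Voo => n Vn; apply: le_lt_trans Vl.
by apply: ereal_sup_ubound; exists n.
Qed.

Lemma limn_einf_ge_near (R : realType) (u : nat -> \bar R) (l : \bar R) :
  (\forall n \near \oo, l <= u n) -> l <= limn_einf u.
Proof.
move=> lu; rewrite /limn_einf leeNr; apply: limn_esup_le_near.
by apply: filterS lu => n; rewrite leeN2.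
Qed.

Lemma limn_einf_gt_near (R : realType) (u : nat -> \bar R) (l : \bar R) :
  l < limn_einf u -> \forall n \near \oo, l < u n.
Proof.
rewrite /limn_einf lteNr => /limn_esup_lt_near.
by apply: filterS => n; rewrite lteN2.
Qed.

(** Together with [ge_rate_lne], this trades logarithms for exponential bounds, in
which the values 0 and -oo of the measure and of its logarithm need no separate
treatment. *)
Lemma le_rate_lne (R : realType) (N : nat) (m : \bar R) (c : R) :
  (0 < N)%N -> 0 <= m ->
  ((N%:R^-1)%:E * lne m <= c%:E) = (m <= (expR (c * N%:R))%:E).
Proof.
move=> N0 m0; rewrite lee_pdivrMl ?ltr0n// -EFinM mulrC -(lee_expeR (lne m)).
by move: (lneK_eq m); rewrite m0 => /eqP ->.
Qed.

Lemma ge_rate_lne (R : realType) (N : nat) (m : \bar R) (c : R) :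
  (0 < N)%N -> 0 <= m ->
  (c%:E <= (N%:R^-1)%:E * lne m) = ((expR (c * N%:R))%:E <= m).
Proof.
move=> N0 m0; rewrite lee_pdivlMl ?ltr0n// -EFinM mulrC -(lee_expeR _ (lne m)).
by move: (lneK_eq m); rewrite m0 => /eqP ->.
Qed.

Lemma ldp_closed_decay (R : realType) (nu : nat -> probability R R)
    (I : R -> \bar R) (F : set R) (c c' : R) :
  large_deviation_principle nu I -> closed F ->
  (forall x, F x -> c'%:E <= I x) -> (c < c')%R ->
  \forall N \near \oo, nu N F <= (expR (- c * N%:R))%:E.
Proof.
move=> [_ up _] cF FI cc'.
have : limn_esup (fun N => (N%:R^-1)%:E * lne (nu N F)) < (- c)%:E.
  apply: le_lt_trans (up _ cF) _.
  rewrite EFinN lteN2; apply: (@lt_le_trans _ _ c'%:E); first by rewrite lte_fin.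
  by apply: le_ereal_inf_tmp => _ [x Fx <-]; exact: FI.
move=> /limn_esup_lt_near H.
near=> N; rewrite -le_rate_lne//; last by near: N; exact: nbhs_infty_gt.
by apply: ltW; near: N.
Unshelve. all: by end_near. Qed.

Lemma ldp_open_growth (R : realType) (nu : nat -> probability R R)
    (I : R -> \bar R) (G : set R) (x c : R) :
  large_deviation_principle nu I -> open G -> G x -> I x < c%:E ->
  \forall N \near \oo, (expR (- c * N%:R))%:E <= nu N G.
Proof.
move=> [_ _ low] oG Gx Ixc.
have : (- c)%:E < limn_einf (fun N => (N%:R^-1)%:E * lne (nu N G)).
  apply: lt_le_trans (low _ oG).
  rewrite EFinN lteN2; apply: le_lt_trans Ixc.
  by apply: ereal_inf_lbound; exists x.
move=> /limn_einf_gt_near H.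
near=> N; rewrite -ge_rate_lne//; last by near: N; exact: nbhs_infty_gt.
by apply: ltW; near: N.
Unshelve. all: by end_near. Qed.

(** * Almost sure exponential bounds for a fixed set *)

(** Borel-Cantelli, with a geometric majorant of the probabilities that only holds
from some rank on; the sequence of events is shifted to start at that rank. *)
Lemma ae_near_of_decay (R : realType) (d : measure_display)
    (Omega : measurableType d) (P : probability Omega R)
    (B : nat -> set Omega) (K c : R) :
  (forall N, measurable (B N)) -> (0 < c)%R ->
  (\forall N \near \oo, P (B N) <= (K * expR (- c * N%:R))%:E) ->
  {ae P, forall w, \forall N \near \oo, ~ B N w}.
Proof.
move=> mB c0 [n0 _ Bd].
pose C := fun n => B (n + n0)%N.
have K0 : (0 <= K)%R.
  have := Bd n0 (leqnn _) => /(le_trans (measure_ge0 _ _)).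
  by rewrite lee_fin pmulr_lge0// expR_gt0.
have C0 : P (lim_sup_set C) = 0.
  apply: lim_sup_set_cvg0; first by move=> n; exact: mB.
  apply: (@le_lt_trans _ _ (\sum_(n <oo) (geometric K (expR (- c)) n)%:E)).
    apply: lee_nneseries => // n _; apply: le_trans (Bd _ (leq_addl _ _)) _.
    rewrite lee_fin ler_wpM2l// -expRM_natr mulr_natr.
    rewrite -mulr_natr ler_expR !mulNr lerN2 ler_pM2l// ler_nat leq_addr//.
  have h : (`|expR (- c)| < 1)%R.
    by rewrite ger0_norm ?expR_ge0// -expR0 ltr_expR oppr_lt0.
  apply: (@le_lt_trans _ _ (K * (1 - expR (- c))^-1)%:E); last exact: ltry.
  apply: lime_le.
    by apply: is_cvg_nneseries => n _ _; rewrite lee_fin mulr_ge0 ?exprn_ge0 ?expR_ge0.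
  apply: nearW => n; rewrite sumEFin lee_fin.
  exact: geometric_le_lim K0 (expR_gt0 _) h.
have mC : measurable (lim_sup_set C).
  by apply: bigcapT_measurable => n; apply: bigcup_measurable => k _; exact: mB.
exists (lim_sup_set C); split => // w /= nw n _ /=.
apply: contrapT => nB; apply: nw; exists (n + n0)%N => // k /= nk Bk.
apply: nB; exists (k - n0)%N => /=; first by rewrite leq_subRL ?(leq_trans _ nk) ?leq_addl// addnC.
by rewrite /C subnK// (leq_trans _ nk) ?leq_addl.
Qed.

Lemma markov_ge0 (R : realType) (d : measure_display)
    (Omega : measurableType d) (P : probability Omega R)
    (f : Omega -> \bar R) (a : R) :
  measurable_fun setT f -> (forall w, 0 <= f w) -> (0 < a)%R ->
  a%:E * P [set w | a%:E <= f w] <= \int[P]_w f w.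
Proof.
move=> mf f0 a0.
have := @le_integral_comp_abse _ _ _ P setT measurableT f a id
  (@measurable_id _ _ _) (fun=> id) _ mf a0.
rewrite setTI (_ : (fun w => _) = f); last first.
  by apply/funext => w /=; rewrite gee0_abs.
rewrite (_ : [set w | _] = [set w | a%:E <= f w]); first by apply.
by apply/funext => w /=; rewrite gee0_abs.
Qed.

Lemma markov_empirical (R : realType) (d : measure_display)
    (Omega : measurableType d) (P : probability Omega R) (N : nat)
    (X : 'I_(2 ^ N) -> {RV P >-> R}) (mu : probability R R)
    (A : set R) (a : R) :
  measurable A -> (forall i, distribution P (X i) A = mu A) -> (0 < a)%R ->
  P [set w | a%:E <= empirical_measure (fun i => X i w) A] <= (a^-1)%:E * mu A.
Proof.
move=> mA XA a0; rewrite lee_pdivlMl//.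
have mX i : measurable (X i @^-1` A) by rewrite -[_ @^-1` _]setTI; exact: measurable_funP.
have m1 i : measurable_fun setT (fun w => \d_(X i w) A : \bar R).
  rewrite (_ : (fun _ => _) = EFin \o \1_(X i @^-1` A)).
    by apply/measurable_EFinP; exact: measurable_indic.
  by apply/funext => w; rewrite diracE/= indicE.
have c0 : (0 <= (2 ^+ N)^-1 :> R)%R by rewrite invr_ge0 exprn_ge0.
apply: (@le_trans _ _ (\int[P]_w empirical_measure (fun i => X i w) A)).
  apply: markov_ge0 a0.
  - rewrite /empirical_measure; apply: emeasurable_funM => //.
    exact: emeasurable_sum.
  - by move=> w; rewrite mule_ge0//; apply: sume_ge0.
rewrite /empirical_measure ge0_integralZl//; last first.
- by move=> w _; apply: sume_ge0.
- exact: emeasurable_sum.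
rewrite ge0_integral_sum//.
have XA' i : \int[P]_w \d_(X i w) A = (fine (mu A))%:E.
  rewrite fineK ?fin_num_measure// -(XA i).
  transitivity (\int[P]_w (\1_(X i @^-1` A) w)%:E).
    by apply: eq_integral => w _; rewrite diracE indicE.
  by rewrite integral_indic// setIT.
rewrite (eq_bigr _ (fun i _ => XA' i)) sumEFin sumr_const card_ord -EFinM.
rewrite -[X in (_ * X)%R]mulr_natl mulrA natrX mulVf// mul1r fineK ?fin_num_measure//.
Qed.

(** The left-hand side is the variance of a sum of pairwise independent indicators.
Expanding the square as (S - m)^2 + 2 m S = S^2 + m^2 keeps every integrand
nonnegative, so additivity of the integral applies without integrability
conditions. *)
Lemma second_moment_events (R : realType) (d : measure_display)
    (Omega : measurableType d) (P : probability Omega R) (n : nat)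
    (B : 'I_n -> set Omega) (p : R) :
  (forall i, measurable (B i)) -> (forall i, P (B i) = p%:E) ->
  (forall i j, i != j -> P (B i `&` B j) = (p * p)%:E) ->
  \int[P]_w ((\sum_(i < n) \1_(B i) w - n%:R * p) ^+ 2)%:E <= (n%:R * p)%:E.
Proof.
move=> mB PB PBB.
have m1 i : measurable_fun setT (\1_(B i) : Omega -> R) by exact: measurable_indic.
pose S w : R := (\sum_(i < n) \1_(B i) w)%R.
have mS : measurable_fun setT S by exact: measurable_sum.
have S0 w : (0 <= S w)%R by apply: sumr_ge0.
have p0 (i : 'I_n) : (0 <= p)%R by rewrite -lee_fin -(PB i).
have m0 : (0 <= n%:R * p)%R.
  by case: (n) p0 => [|k] p0; rewrite ?mul0r// mulr_ge0// (p0 ord0).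
set m := (n%:R * p)%R in m0 *.
have ES : \int[P]_w (S w)%:E = m%:E.
  under eq_integral do rewrite -sumEFin.
  rewrite ge0_integral_sum//; last by move=> i; exact/measurable_EFinP.
  rewrite (eq_bigr (fun=> p%:E)); last first.
    by move=> i _; rewrite integral_indic// setIT; exact: PB.
  by rewrite sumEFin sumr_const card_ord -mulr_natl.
have ES2 : \int[P]_w (S w ^+ 2)%:E = (m + n%:R * (n%:R - 1) * p ^+ 2)%:E.
  transitivity (\int[P]_w (\sum_(i < n) \sum_(j < n) (\1_(B i `&` B j) w)%:E)).
    apply: eq_integral => w _; rewrite expr2 /S mulr_suml -sumEFin.
    apply: eq_bigr => i _; rewrite mulr_sumr -sumEFin; apply: eq_bigr => j _.
    by rewrite indicI.
  rewrite ge0_integral_sum//=; last 2 first.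
  - move=> i; apply: emeasurable_sum => j; apply/measurable_EFinP.
    by apply: measurable_indic; exact: measurableI.
  - by move=> i w _; apply: sume_ge0 => j _; rewrite lee_fin.
  transitivity (\sum_(i < n) (p + (n%:R - 1) * p ^+ 2)%:E).
    apply: eq_bigr => i _; rewrite ge0_integral_sum//=; last first.
      move=> j; apply/measurable_EFinP.
      by apply: measurable_indic; exact: measurableI.
    have PIB j : \int[P]_w (\1_(B i `&` B j) w)%:E = P (B i `&` B j).
      by rewrite integral_indic ?setIT//; exact: measurableI.
    rewrite (eq_bigr _ (fun j _ => PIB j)) (bigD1 i)//= setIid PB.
    rewrite (eq_bigr (fun=> (p ^+ 2)%:E)); last by move=> j ji; rewrite PBB 1?eq_sym.
    rewrite sumEFin sumr_const -EFinD cardC1 card_ord -[X in (_ + X)%:E]mulr_natl.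
    have -> : (n.-1%:R = n%:R - 1 :> R)%R; last by [].
    by rewrite -subn1 natrB// (leq_trans _ (ltn_ord i)).
  rewrite sumEFin sumr_const card_ord.
  by rewrite -[LHS]/((_ *+ n)%:E) -[X in X%:E]mulr_natl /m; congr EFin; ring.
have : \int[P]_w ((S w - m) ^+ 2)%:E + \int[P]_w ((2 * m) * S w)%:E
    = \int[P]_w (S w ^+ 2)%:E + \int[P]_w (m ^+ 2)%:E.
  rewrite -!ge0_integralD//.
  - by apply: eq_integral => w _; rewrite -!EFinD; congr EFin; ring.
  - by move=> w _; rewrite lee_fin sqr_ge0.
  - by apply/measurable_EFinP; apply: measurable_funX.
  - by move=> w _; rewrite lee_fin sqr_ge0.
  - by move=> w _; rewrite lee_fin sqr_ge0.
  - by apply/measurable_EFinP; apply: measurable_funX; apply: measurable_funB.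
  - by move=> w _; rewrite lee_fin; apply: mulr_ge0 => //; apply: mulr_ge0.
  - by apply/measurable_EFinP; apply: measurable_funM.
have -> : \int[P]_w ((2 * m) * S w)%:E = (2 * m * m)%:E.
  under eq_integral do rewrite EFinM.
  rewrite ge0_integralZl_EFin//; last 3 first.
  - by move=> w _; rewrite lee_fin.
  - exact/measurable_EFinP.
  - by rewrite mulr_ge0.
  by rewrite ES -EFinM.
rewrite ES2.
have -> : \int[P]_w (m ^+ 2)%:E = (m ^+ 2)%:E.
  by rewrite integral_cst//= probability_setT mule1.
rewrite -EFinD.
case: (\int[P]_w _) => [r||]//= [H].
rewrite lee_fin.
have -> : (r = m - m * p)%R by apply: (addIr (2 * m * m)%R); rewrite H /m; ring.
by rewrite gerBl /m -mulrA mulr_ge0// -expr2 sqr_ge0.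
Qed.

(** Chebyshev's inequality at distance half the mean, the variance being at most the
mean. *)
Lemma lower_tail_events (R : realType) (d : measure_display)
    (Omega : measurableType d) (P : probability Omega R) (n : nat)
    (B : 'I_n -> set Omega) (p : R) :
  (forall i, measurable (B i)) -> (forall i, P (B i) = p%:E) ->
  (forall i j, i != j -> P (B i `&` B j) = (p * p)%:E) ->
  (0 < n%:R * p)%R ->
  P [set w | (\sum_(i < n) \1_(B i) w <= n%:R * p / 2)%R]
    <= (4 / (n%:R * p))%:E.
Proof.
move=> mB PB PBB; have := second_moment_events mB PB PBB.
set m := (n%:R * p)%R => V m0.
have mS : measurable_fun setT (fun w => \sum_(i < n) \1_(B i) w : R)%R.
  by apply: measurable_sum => i; exact: measurable_indic.
have mV : measurable_fun setT (fun w => ((\sum_(i < n) \1_(B i) w - m) ^+ 2)%:E).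
  by apply/measurable_EFinP; apply: measurable_funX; apply: measurable_funB.
have a0 : (0 < (m / 2) ^+ 2)%R by rewrite exprn_gt0// divr_gt0.
have V0 w : 0 <= ((\sum_(i < n) \1_(B i) w - m) ^+ 2)%:E by rewrite lee_fin sqr_ge0.
have := le_trans (markov_ge0 P mV V0 a0) V.
rewrite -lee_pdivlMl// -EFinM.
have -> : (((m / 2) ^+ 2)^-1 * m = 4 / m)%R by field; rewrite gt_eqF.
apply: le_trans; apply: le_measure; rewrite ?inE.
- by rewrite -[X in measurable X]setTI; apply: measurable_fun_le.
- by rewrite -[X in measurable X]setTI; apply: emeasurable_fun_c_infty.
- move=> w /= Sm; rewrite lee_fin -sqrrN opprB.
  rewrite ler_sqr ?nnegrE; [|by rewrite divr_ge0// ltW|]; nra.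
Qed.

Lemma mutually_independent_pair (R : realType) (d : measure_display)
    (Omega : measurableType d) (P : probability Omega R) (I : finType)
    (X : I -> {RV P >-> R}) (A : set R) (i j : I) :
  mutually_independent X -> measurable A -> i != j ->
  P ((X i @^-1` A) `&` (X j @^-1` A)) = P (X i @^-1` A) * P (X j @^-1` A).
Proof.
move=> indX mA ij.
have := indX [set i; j]%SET (fun=> A) (fun=> mA).
rewrite (bigD1 i) ?inE ?eqxx//= (bigD1 j)/=; last by rewrite !inE eqxx orbT eq_sym.
rewrite big1 ?mule1; last first.
  by move=> k; rewrite !inE => /andP[/andP[+ /negbTE ki] /negbTE kj]; rewrite ki kj.
move=> <-; congr (P _); apply/seteqP; split => w /=.
  by move=> [wi wj] k; rewrite /= !inE => /orP[|] /eqP ->.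
by move=> h; split; apply: h; rewrite /= !inE eqxx ?orbT.
Qed.

Lemma empirical_measureE (R : realType) (T : Type) (N : nat)
    (X : 'I_(2 ^ N) -> T -> R) (A : set R) (w : T) :
  empirical_measure (fun i => X i w) A
  = ((2 ^+ N)^-1 * \sum_(i < 2 ^ N) \1_(X i @^-1` A) w)%:E.
Proof.
by rewrite EFinM -sumEFin; congr (_ * _); apply: eq_bigr => i _; rewrite diracE indicE.
Qed.

(** The expectation of the empirical mass of A is the mass of A under the common
law, so by Markov's inequality the exceptional probabilities are at most
exp(- (c' - c) N), which is summable. *)
Lemma ae_empirical_decay (R : realType) (lam : nat -> probability R R)
    (d : measure_display) (Omega : measurableType d) (P : probability Omega R)
    (xi : forall N : nat, 'I_(2 ^ N) -> {RV P >-> R}) (A : set R) (c c' : R) :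
  (forall N : nat, (1 <= N)%N -> iid (xi N) (lam N)) -> measurable A ->
  (c < c')%R ->
  (\forall N \near \oo, lam N A <= (expR (- c' * N%:R))%:E) ->
  {ae P, forall w, \forall N \near \oo,
    empirical_measure (fun i => xi N i w) A <= (expR (- c * N%:R))%:E}.
Proof.
move=> iidxi mA cc' lamA.
pose B N := [set w | (expR (- c * N%:R))%:E
                     <= empirical_measure (fun i => xi N i w) A].
have mX N i : measurable (xi N i @^-1` A).
  by rewrite -[X in measurable X]setTI; exact: measurable_funP.
have : {ae P, forall w, \forall N \near \oo, ~ B N w}.
  apply: (@ae_near_of_decay _ _ _ _ _ 1%R (c' - c)%R); last 2 first.
  - by rewrite subr_gt0.
  - near=> N; have N1 : (1 <= N)%N by near: N; exact: nbhs_infty_gt.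
    have [_ /(_ _ _ mA) xiA] := iidxi N N1.
    apply: le_trans (markov_empirical mA xiA (expR_gt0 _)) _.
    rewrite lee_pdivrMl ?expR_gt0// -EFinM mul1r -expRD.
    rewrite (_ : _ + _ = - c' * N%:R)%R; last by ring.
    by near: N.
  - move=> N; rewrite -[X in measurable X]setTI.
    apply: emeasurable_fun_c_infty => //.
    rewrite (_ : (fun w => _) = EFin \o (fun w =>
        (2 ^+ N)^-1 * \sum_(i < 2 ^ N) \1_(xi N i @^-1` A) w)%R); last first.
      by apply/funext => w; exact: empirical_measureE (xi N) A w.
    apply/measurable_EFinP; apply: measurable_funM => //.
    by apply: measurable_sum => i; exact: measurable_indic.
apply: filterS => w; apply: filterS => N /negP; rewrite -ltNge; exact: ltW.
Unshelve. all: by end_near. Qed.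

(** The expected number of points in A is at least exp((ln 2 - c) N), so the
probability that fewer than half as many fall in A is at most
4 exp(- (ln 2 - c) N), which is summable since c < ln 2. The lost factor 1/2 is
absorbed by enlarging the exponent from c to c'. *)
Lemma ae_empirical_growth (R : realType) (lam : nat -> probability R R)
    (d : measure_display) (Omega : measurableType d) (P : probability Omega R)
    (xi : forall N : nat, 'I_(2 ^ N) -> {RV P >-> R}) (A : set R) (c c' : R) :
  (forall N : nat, (1 <= N)%N -> iid (xi N) (lam N)) -> measurable A ->
  (c < c')%R -> (c < ln 2)%R ->
  (\forall N \near \oo, (expR (- c * N%:R))%:E <= lam N A) ->
  {ae P, forall w, \forall N \near \oo,
    (expR (- c' * N%:R))%:E <= empirical_measure (fun i => xi N i w) A}.
Proof.
move=> iidxi mA cc' c2 lamA.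
pose p N := fine (lam N A).
pose B N := [set w | (\sum_(i < 2 ^ N) \1_(xi N i @^-1` A) w
                      <= (2 ^ N)%:R * p N / 2)%R].
have mX N i : measurable (xi N i @^-1` A).
  by rewrite -[X in measurable X]setTI; exact: measurable_funP.
have pE N : lam N A = (p N)%:E by rewrite fineK// fin_num_measure.
have pA : \forall N \near \oo, (expR (- c * N%:R) <= p N)%R.
  by apply: filterS lamA => N; rewrite pE lee_fin.
(* The sample size 2 ^ N on the exponential scale. *)
have expln2 N : (expR (ln 2 * N%:R) = 2 ^+ N :> R)%R.
  by rewrite expRM_natr lnK// posrE.
have : {ae P, forall w, \forall N \near \oo, ~ B N w}.
  apply: (@ae_near_of_decay _ _ _ _ _ 4%R (ln 2 - c)%R); last 2 first.
  - by rewrite subr_gt0.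
  - near=> N; have N1 : (1 <= N)%N by near: N; exact: nbhs_infty_gt.
    have [indxi /(_ _ _ mA) xiA] := iidxi N N1.
    have xip i : P (xi N i @^-1` A) = (p N)%:E by rewrite -pE -(xiA i).
    have pN : (expR (- c * N%:R) <= p N)%R by near: N.
    have p0 : (0 < p N)%R by apply: lt_le_trans pN; exact: expR_gt0.
    apply: le_trans (lower_tail_events (mX N) xip _ _) _.
    + by move=> i j ij; rewrite mutually_independent_pair// !xip.
    + by rewrite mulr_gt0// ltr0n expn_gt0.
    rewrite lee_fin ler_pM2l// -[leRHS]invrK lef_pV2 ?posrE ?invr_gt0 ?expR_gt0//; last first.
      by rewrite mulr_gt0// ltr0n expn_gt0.
    rewrite -expRN natrX -expln2 (_ : - _ = ln 2 * N%:R + - c * N%:R)%R; last by ring.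
    by rewrite expRD ler_pM2l ?expR_gt0.
  - move=> N; rewrite -[X in measurable X]setTI; apply: measurable_fun_le => //.
    by apply: measurable_sum => i; exact: measurable_indic.
apply: filterS => w nB; near=> N.
have : ~ B N w by near: N.
move=> /negP; rewrite -ltNge (empirical_measureE (xi N) A w) lee_fin => h.
rewrite -ler_pdivrMl ?invr_gt0 ?exprn_gt0// invrK; apply: le_trans (ltW h).
rewrite natrX -mulrA ler_pM2l ?exprn_gt0//.
have pN : (expR (- c * N%:R) <= p N)%R by near: N.
rewrite ler_pdivlMr//; apply: le_trans pN.
rewrite (_ : - c * N%:R = - c' * N%:R + (c' - c) * N%:R)%R; last by ring.
rewrite expRD ler_pM2l ?expR_gt0// -[leLHS](@lnK R) ?posrE// ler_expR.
rewrite -ler_pdivrMl ?subr_gt0//.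
near: N; exact: nbhs_infty_ger.
Unshelve. all: by end_near. Qed.

(** * Zeros and monotonicity of the rate function *)

Lemma ereal_between (R : realType) (x y : \bar R) :
  x < y -> exists2 r : R, x < r%:E & r%:E < y.
Proof.
case: x y => [x||] [y||]//=; rewrite ?lte_fin => xy.
- by exists ((x + y) / 2)%R; rewrite lte_fin ?midf_lt.
- by exists (x + 1)%R; rewrite ?ltry// lte_fin ltrDl.
- by exists (y - 1)%R; rewrite ?ltNyr// lte_fin ltrBlDr ltrDl.
- by exists 0%R; rewrite ?ltry ?ltNyr.
Qed.

(** Each point of K has a neighbourhood on which I exceeds a positive constant;
compactness makes the constant uniform. *)
Lemma lsc_compact_gt0 (R : realType) (X : topologicalType) (I : X -> \bar R)
    (K : set X) :
  lower_semicontinuous I -> compact K -> (forall x, K x -> 0 < I x) ->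
  exists2 c : R, (0 < c)%R & forall x, K x -> c%:E <= I x.
Proof.
move=> lscI /compact_near_coveringP cK KI.
have : \forall c \near (0%R : R)^'+, K `<=` [set x | c%:E <= I x].
  apply: (cK R (0%R : R)^'+ (fun c x => c%:E <= I x)) => x /KI /ereal_between[a a0 aI].
  have [V xV VI] := lscI _ _ aI.
  exists (V, [set c : R | c < a]%R).
    by split => //=; apply: nbhs_right_lt; rewrite -lte_fin.
  move=> [y c] /= [Vy ca]; apply: ltW; apply: lt_trans (VI _ Vy).
  by rewrite lte_fin.
move=> H; near (0%R : R)^'+ => c; exists c.
  by near: c; exact: nbhs_right_gt.
by move=> x; apply: (_ : K `<=` [set x | c%:E <= I x]); near: c.
Unshelve. all: by end_near. Qed.

Lemma weak_convergence_tight (R : realType) (nu : nat -> probability R R)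
    (mu : probability R R) :
  weak_convergence nu mu ->
  exists M : R, \forall N \near \oo, (2^-1)%:E < nu N `[(- M)%R, M]%classic.
Proof.
move=> numu.
have [n Fn] : exists n : nat, (2^-1)%:E < mu `[(- n%:R)%R, (n%:R)%R]%classic.
  have := @nondecreasing_cvg_mu _ _ _ mu (fun n => `[(- n%:R)%R, (n%:R)%R]%classic).
  have -> : \bigcup_n `[(- n%:R)%R, (n%:R)%R]%classic = [set: R].
    apply/seteqP; split => // x _.
    exists (Num.bound `|x|) => //=; rewrite in_itv/= -ler_norml.
    by apply: ltW; exact: archi_boundP.
  move=> h; have /h cvg1 : forall i : nat, measurable `[(- i%:R)%R, (i%:R)%R : R]%classic.
    by move=> i; exact: measurable_itv.
  have {h}cvg1 : mu `[(- n%:R)%R, (n%:R)%R]%classic @[n --> \oo] --> 1.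
    rewrite -(probability_setT mu); apply: cvg1 => // i j ij.
    apply/subsetPset => x /=; rewrite !in_itv/= => /andP[ix xi].
    by rewrite (le_trans _ ix) ?lerN2 ?ler_nat// (le_trans xi)// ler_nat.
  have h : (2^-1)%:E < 1 :> \bar R by rewrite lte_fin invf_lt1 ?ltr1n.
  have [n _ /(_ n (leqnn n)) nP] := cvg1 _ (open_ereal_gt' h).
  by exists n.
(* A continuous function between the indicators of [-n, n] and [-n-1, n+1],
   through which weak convergence transfers mass from mu to nu N. *)
pose f (x : R) : R := Num.max 0%R (Num.min 1%R (n%:R + 1 - `|x|)%R).
have f0 x : (0 <= f x)%R by rewrite /f le_max lexx.
have f1 x : (f x <= 1)%R by rewrite /f ge_max ler01 ge_min lexx.
have cf : continuous f.
  apply: (@max_fun_continuous _ R R (cst 0%R)); first exact: cst_continuous.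
  apply: (@min_fun_continuous _ R R (cst 1%R)); first exact: cst_continuous.
  move=> x; apply: (@cvgB R R^o); first exact: cvg_cst.
  exact: norm_continuous.
have mf : measurable_fun setT (EFin \o f).
  by apply/measurable_EFinP; exact: continuous_measurable_fun.
have bf : [bounded f x | x in [set: R]].
  exists 1%R; split => // y y1 x _ /=.
  by rewrite ger0_norm// (le_trans (f1 x))// ltW.
have /(_ f cf bf) := numu.
have muf : (2^-1)%:E < \int[mu]_x (f x)%:E.
  apply: lt_le_trans Fn _.
  rewrite [leLHS](_ : _ = \int[mu]_x (\1_(`[(- n%:R)%R, (n%:R)%R]%classic) x)%:E).
    apply: ge0_le_integral => //.
    - by apply/measurable_EFinP; exact: measurable_indic.
    - move=> x _; rewrite lee_fin indicE; case: (boolP (x \in _)) => // /[!inE]/=.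
      rewrite in_itv/= -ler_norml => xn; rewrite /f le_max le_min lexx/=.
      by apply/orP; right; lra.
  by rewrite integral_indic// setIT.
move=> cvgf; have H : \forall N \near \oo, (2^-1)%:E < \int[nu N]_x (f x)%:E :=
  cvgf _ (open_ereal_gt' muf); exists (n%:R + 1)%R.
apply: filterS H => N /lt_le_trans; apply.
rewrite [leRHS](_ : _ = \int[nu N]_x (\1_(`[(- (n%:R + 1))%R, (n%:R + 1)%R]%classic) x)%:E).
  apply: ge0_le_integral => //.
  - by move=> x _; rewrite lee_fin.
  - by apply/measurable_EFinP; exact: measurable_indic.
  - move=> x _; rewrite lee_fin indicE; case: (boolP (x \in _)) => [//|/negP/=].
    rewrite inE/= in_itv/= -ler_norml => /negP; rewrite -ltNge => xn.
    rewrite /f ge_max lexx ge_min; apply/orP; right; lra.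
by rewrite integral_indic// setIT.
Qed.

(** Were I positive everywhere, it would be bounded below by a positive constant on
the compact interval given by tightness, and the upper bound of the large
deviation principle would make the mass of this interval vanish, although it
stays above 1/2. *)
Lemma rate_function_has_zero (R : realType) (lam : nat -> probability R R)
    (lambda : probability R R) (I : R -> \bar R) :
  weak_convergence lam lambda -> large_deviation_principle lam I ->
  exists x0, I x0 = 0.
Proof.
move=> /weak_convergence_tight[M lamM] ldp.
have [[I0 lscI] _ _] := ldp.
apply: contrapT => noz.
have [|c c0 Ic] := lsc_compact_gt0 lscI (@segment_compact R (- M)%R M).
  move=> x _; rewrite lt0e I0 andbT; by apply/eqP => Ix; apply: noz; exists x.
have c2 : (c / 2 < c)%R by rewrite ltr_pdivrMr// mulr_natr mulr2n ltrDl.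
have := ldp_closed_decay ldp (@itv_closed _ _ (- M)%R M) Ic c2.
move=> decay; near \oo => N.
have : (2^-1)%:E < (expR (- (c / 2) * N%:R))%:E.
  apply: (@lt_le_trans _ _ (lam N `[(- M)%R, M]%classic)).
    by near: N.
  by near: N.
rewrite lte_fin ltNge => /negP; apply.
rewrite mulNr expRN lef_pV2 ?posrE ?expR_gt0//.
rewrite -[leLHS](@lnK R) ?posrE// ler_expR.
rewrite -ler_pdivrMl ?divr_gt0//.
by near: N; exact: nbhs_infty_ger.
Unshelve. all: by end_near. Qed.

Lemma convex_segment_zero (R : realType) (I : R -> \bar R) (x0 y t : R) :
  convex_efunction I -> I x0 = 0 -> (0 <= t <= 1)%R ->
  I (t * y + (1 - t) * x0)%R <= t%:E * I y.
Proof. by move=> cvxI Ix0 t01; have := cvxI y x0 t t01; rewrite Ix0 mule0 adde0. Qed.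

(** x lies on the segment from x0 to y, where convexity bounds I by a fraction of
I y. The disjunction covers both sides of x0. *)
Lemma convex_mono_away_from_zero (R : realType) (I : R -> \bar R) (x0 x y : R) :
  convex_efunction I -> I x0 = 0 -> (forall x, 0 <= I x) ->
  (x0 <= x <= y)%R || (y <= x <= x0)%R -> I x <= I y.
Proof.
move=> cvxI Ix0 I0 xy.
have [yx0|yx0] := eqVneq y x0.
  have -> : x = x0 by move: xy; rewrite yx0; lra.
  by rewrite Ix0.
pose s := ((x - x0) / (y - x0))%R.
have s01 : (0 <= s <= 1)%R.
  rewrite /s; case/orP: xy => /andP[h1 h2].
    have yx : (0 < y - x0)%R by rewrite subr_gt0 lt_neqAle eq_sym yx0 (le_trans h1).
    by rewrite divr_ge0 ?subr_ge0 ?(le_trans h1)//= ler_pdivrMr// mul1r lerB.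
  have yx : (0 < x0 - y)%R by rewrite subr_gt0 lt_neqAle yx0 (le_trans h1).
  rewrite -[(x - x0)%R]opprB -[(y - x0)%R]opprB invrN mulrNN.
  by rewrite divr_ge0 ?subr_ge0 ?(le_trans h1)//= ler_pdivrMr// mul1r lerB.
have -> : x = (s * y + (1 - s) * x0)%R by rewrite /s; field; rewrite subr_eq0.
apply: le_trans (convex_segment_zero _ cvxI Ix0 s01) _.
case/andP: s01 => s0 s1.
by rewrite -[leRHS]mul1e lee_wpmul2r// ?lee_fin.
Qed.

(** * Reduction to countably many sets *)

(** The largest point b of F on the left of x0 differs from x0, and by lower
semicontinuity J still exceeds c slightly to the right of b, where a rational
number can be found. *)
Lemma closed_left_cover (R : realType) (J : R -> \bar R) (F : set R)
    (x0 c : R) :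
  lower_semicontinuous J -> closed F -> ~ F x0 ->
  (forall x, F x -> c%:E < J x) ->
  (forall x, F x -> (x0 < x)%R) \/
  exists q : rat, [/\ (ratr q < x0)%R, c%:E < J (ratr q)
    & forall x, F x -> (x <= x0)%R -> (x <= ratr q)%R].
Proof.
move=> lscJ cF Fx0 FJ.
pose L := F `&` [set x | (x <= x0)%R].
have [[y Ly]|L0] := pselect (L !=set0); last first.
  left=> x Fx; rewrite ltNge; apply/negP => xx0; apply: L0; by exists x.
right.
have ubL : ubound L x0 by move=> x [].
have supL : has_sup L by split; [exists y|exists x0].
have cL : closed L by apply: closedI => //; exact: closed_le.
have := @closure_sup R L (ex_intro _ y Ly) (ex_intro _ x0 ubL).
rewrite -((closure_id L).1 cL) => -[Fb bx0].
have {}bx0 : (sup L < x0)%R.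
  by rewrite lt_neqAle bx0 andbT; apply/eqP => b; apply: Fx0; rewrite -b.
have [V /nbhs_ballP[e /= e0 eV] VJ] := lscJ _ _ (FJ _ Fb).
have : (sup L < Num.min x0 (sup L + e))%R by rewrite lt_min bx0 ltrDl.
move=> /rat_in_itvoo[q]; rewrite in_itv/= lt_min => /and3P[bq qx0 qe].
exists q; split => //.
  apply: VJ; apply: eV; rewrite /ball/= ltr_distlC; lra.
by move=> x Fx xx0; apply: le_trans (ltW bq); apply: ub_le_sup => //; exists x0.
Qed.

(** The mass is a number of points divided by 2 ^ N. *)
Lemma empirical_measure_discrete (R : realType) (N : nat) (x : 'I_(2 ^ N) -> R)
    (A : set R) :
  empirical_measure x A < ((2 ^+ N)^-1)%:E -> empirical_measure x A = 0.
Proof.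
have E : \sum_(i < 2 ^ N) \d_(x i) A = ((\sum_(i < 2 ^ N) (x i \in A))%N%:R)%:E :> \bar R.
  rewrite natr_sum -sumEFin; apply: eq_bigr => i _; exact: diracE.
rewrite /empirical_measure E -EFinM lte_fin.
rewrite -[ltRHS]mulr1 ltr_pM2l ?invr_gt0 ?exprn_gt0//.
rewrite (ltr_nat R _ 1) ltnS leqn0 => /eqP ->.
by rewrite mulr0.
Qed.

Lemma ae_forall_countable (R : realType) (d : measure_display)
    (Omega : measurableType d) (P : probability Omega R) (T : countType)
    (Q : T -> Omega -> Prop) :
  (forall t, {ae P, forall w, Q t w}) -> {ae P, forall w, forall t, Q t w}.
Proof.
move=> aeQ.
have : {ae P, forall w, forall n : nat, if unpickle n is Some t then Q t w else True}.
  by apply: ae_foralln => n; case: (unpickle n) => [t|]; [exact: aeQ|exact: aeW].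
by apply: filterS => w Qw t; have := Qw (pickle t); rewrite pickleK.
Qed.

Lemma rate_function_truncate (R : realType) (X : topologicalType)
    (I : X -> \bar R) (L : R) :
  rate_function I -> rate_function (fun x => if I x <= L%:E then I x else +oo).
Proof.
move=> [I0 lscI]; split=> [x|x a /=]; first by case: ifP.
case: ifPn => [IxL aI|]; last rewrite -ltNge => LI _.
  have [V xV VI] := lscI _ _ aI; exists V => // y /VI ay.
  by case: ifP; rewrite ?ltry.
have [V xV VI] := lscI _ _ LI; exists V => // y /VI Ly.
by rewrite leNgt Ly ltry.
Qed.

(** [closed_left_cover] under the reflection of the line. *)
Lemma closed_right_cover (R : realType) (J : R -> \bar R) (F : set R)
    (x0 c : R) :
  lower_semicontinuous J -> closed F -> ~ F x0 ->
  (forall x, F x -> c%:E < J x) ->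
  (forall x, F x -> (x < x0)%R) \/
  exists q : rat, [/\ (x0 < ratr q)%R, c%:E < J (ratr q)
    & forall x, F x -> (x0 <= x)%R -> (ratr q <= x)%R].
Proof.
move=> lscJ cF Fx0 FJ.
have := @closed_left_cover _ (J \o -%R) (-%R @^-1` F) (- x0)%R c.
case.
- move=> x a /= /lscJ[V xV VJ]; exists (-%R @^-1` V); last by move=> y /VJ.
  exact: (@opp_continuous R x V xV).
- by apply: closed_comp => // x _; exact: (@opp_continuous R).
- by rewrite /= opprK.
- by move=> x /FJ.
- move=> h; left => x Fx; rewrite -ltrN2; apply: h; by rewrite /= opprK.
- move=> [q [qx0 qJ h]]; right; exists (- q)%R; rewrite rmorphN; split => //.
    by rewrite ltrNr.
  move=> x Fx xx0; rewrite lerNl; apply: h; by rewrite /= ?opprK ?lerN2.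
Qed.

(** Almost sure decay is only known for rational exponents below the infimum of I.
Beyond the level ln 2 it gives decay faster than 2 ^- N, hence mass 0 by
discreteness and decay at every rate: this is how the truncation of I enters the
upper bound. *)
Lemma truncated_decay (R : realType) (I : R -> \bar R)
    (x : forall N : nat, 'I_(2 ^ N) -> R) (A : set R) (z c : R) :
  (forall y, A y -> I z <= I y) ->
  c%:E < (if I z <= (ln 2)%:E then I z else +oo) ->
  (forall c1 : rat,
    (exists2 c2 : R, (ratr c1 < c2)%R & forall y, A y -> c2%:E <= I y) ->
    \forall N \near \oo,
      empirical_measure (x N) A <= (expR (- ratr c1 * N%:R))%:E) ->
  exists2 c' : R, (c < c')%R &
    \forall N \near \oo, empirical_measure (x N) A <= (expR (- c' * N%:R))%:E.
Proof.
move=> zA cz decay.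
have key (b : R) : b%:E < I z -> exists2 b' : R, (b < b')%R &
    \forall N \near \oo, empirical_measure (x N) A <= (expR (- b' * N%:R))%:E.
  move=> /ereal_between[b2 bb2 b2I].
  have /rat_in_itvoo[b1] : (b < b2)%R by rewrite -lte_fin.
  rewrite in_itv/= => /andP[bb1 b1b2]; exists (ratr b1) => //.
  apply: decay; exists b2 => // y /zA; exact/le_trans/ltW.
move: cz; case: ifPn => [_ /key//|]; rewrite -ltNge => /key[b b2 dec] _.
(* The mass is eventually 0, so any exponent beyond c will do. *)
exists (c + 1)%R; first by rewrite ltrDl.
near=> N; have N0 : (0 < N)%N by near: N; exact: nbhs_infty_gt.
rewrite empirical_measure_discrete ?lee_fin ?expR_ge0//.
apply: (@le_lt_trans _ _ (expR (- b * N%:R))%:E); first by near: N.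
rewrite lte_fin -[X in (X ^+ _)%R](@lnK R) ?posrE// -expRM_natr -expRN ltr_expR.
by rewrite mulNr ltrN2 ltr_pM2r ?ltr0n.
Unshelve. all: by end_near. Qed.

Lemma ereal_inf_oppe_ge (R : realType) (a b : \bar R) :
  (forall c : R, c%:E < b -> a <= (- c)%:E) -> a <= - b.
Proof.
move=> h; rewrite leNgt; apply/negP; rewrite lteNl => /ereal_between[c ac cb].
by have := h _ cb; rewrite leNgt EFinN lteNl ac.
Qed.

(** * The two bounds for a given realisation of the samples *)

(** If c is nonnegative and below the infimum over F, then x0 is not in F. So F is
contained in a half-line on each side of x0 (or in nothing), and by monotonicity
the infimum of I over each half-line is attained at its rational endpoint. *)
Lemma empirical_upper_bound (R : realType) (I : R -> \bar R)
    (x : forall N : nat, 'I_(2 ^ N) -> R) (x0 : R) :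
  rate_function I -> convex_efunction I -> I x0 = 0 ->
  (forall (A : set R) (q c : rat),
    A = `]-oo, ratr q]%classic \/ A = `[ratr q, +oo[%classic ->
    (exists2 c' : R, (ratr c < c')%R & forall y, A y -> c'%:E <= I y) ->
    \forall N \near \oo,
      empirical_measure (x N) A <= (expR (- ratr c * N%:R))%:E) ->
  forall F : set R, closed F ->
    limn_esup (fun N => (N%:R^-1)%:E * lne (empirical_measure (x N) F))
    <= - ereal_inf [set (if I y <= (ln 2)%:E then I y else +oo) | y in F].
Proof.
move=> rateI cvxI Ix0 decay F cF.
set J := fun y => if I y <= (ln 2)%:E then I y else +oo; have [I0 _] := rateI.
have [_ lscJ] : rate_function J by exact: rate_function_truncate.
apply: ereal_inf_oppe_ge => c cF_J; apply: limn_esup_le_near.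
have FJ y : F y -> c%:E < J y.
  by move=> Fy; apply: lt_le_trans cF_J _; apply: ereal_inf_lbound; exists y.
have [c0|c0] := ltP c 0%R.
  near=> N; have N0 : (0 < N)%N by near: N; exact: nbhs_infty_gt.
  rewrite le_rate_lne//; apply: (@le_trans _ _ 1).
    by apply: probability_le1; exact: closed_measurable.
  by rewrite lee_fin -expR0 ler_expR mulr_ge0// oppr_ge0 ltW.
have Fx0 : ~ F x0 by move=> /FJ; rewrite /J Ix0 lee_fin ln_ge0 ?ler1n// lte_fin ltNge c0.
have mono := convex_mono_away_from_zero cvxI Ix0 I0.
have halves : exists A B : set R, [/\ measurable A, measurable B, F `<=` A `|` B,
    exists2 a : R, (c < a)%R & \forall N \near \oo,
      empirical_measure (x N) A <= (expR (- a * N%:R))%:E &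
    exists2 b : R, (c < b)%R & \forall N \near \oo,
      empirical_measure (x N) B <= (expR (- b * N%:R))%:E].
  have trivial_half : exists2 a : R, (c < a)%R & \forall N \near \oo,
      empirical_measure (x N) set0 <= (expR (- a * N%:R))%:E.
    exists (c + 1)%R; first by rewrite ltrDl.
    by apply: nearW => N; rewrite measure0 lee_fin expR_ge0.
  have [A [mA FA decA]] : exists A : set R, [/\ measurable A,
      forall y, F y -> (y <= x0)%R -> A y &
      exists2 a : R, (c < a)%R & \forall N \near \oo,
      empirical_measure (x N) A <= (expR (- a * N%:R))%:E].
    have [h|[q [qx0 qJ h]]] := closed_left_cover lscJ cF Fx0 FJ.
      by exists set0; split => // y /h; rewrite ltNge => /negbTE ->.
    exists `]-oo, ratr q]%classic; split => //.
    apply: truncated_decay qJ _ => [y|c1]; last by apply: decay; left.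
    by rewrite /= in_itv/= => yq; apply: mono; rewrite yq (ltW qx0) orbT.
  have [B [mB FB decB]] : exists B : set R, [/\ measurable B,
      forall y, F y -> (x0 <= y)%R -> B y &
      exists2 b : R, (c < b)%R & \forall N \near \oo,
      empirical_measure (x N) B <= (expR (- b * N%:R))%:E].
    have [h|[q [qx0 qJ h]]] := closed_right_cover lscJ cF Fx0 FJ.
      by exists set0; split => // y /h; rewrite ltNge => /negbTE ->.
    exists `[ratr q, +oo[%classic; split => //.
      by move=> y Fy yx0; rewrite /= in_itv/= h.
    apply: truncated_decay qJ _ => [y|c1]; last by apply: decay; right.
    by rewrite /= in_itv/= andbT => yq; apply: mono; rewrite yq (ltW qx0).
  exists A, B; split => // y Fy.
  by have [/(FA _ Fy)|/ltW/(FB _ Fy)] := leP y x0; [left|right].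
have [A [B [mA mB FAB [a ca decA] [b cb decB]]]] := halves.
(* The two half-lines contribute 2 exp(- m N), and the gap m - c absorbs the
   factor 2 for large N. *)
pose m := Num.min a b.
have cm : (0 < m - c)%R by rewrite subr_gt0 lt_min ca.
near=> N; have N0 : (0 < N)%N by near: N; exact: nbhs_infty_gt.
rewrite le_rate_lne//; apply: (@le_trans _ _ (empirical_measure (x N) (A `|` B))).
  apply: le_measure; rewrite ?inE//; [exact: closed_measurable|exact: measurableU].
apply: le_trans (measureU2 _ _ _) _ => //.
have mle (k : R) : (m <= k)%R -> (expR (- k * N%:R) <= expR (- m * N%:R))%R.
  by move=> mk; rewrite ler_expR ler_wpM2r// lerN2.
apply: (@le_trans _ _ ((expR (- m * N%:R))%:E + (expR (- m * N%:R))%:E)).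
  apply: leeD.
    apply: (@le_trans _ _ (expR (- a * N%:R))%:E); first by near: N.
    by rewrite lee_fin mle// ge_min lexx.
  apply: (@le_trans _ _ (expR (- b * N%:R))%:E); first by near: N.
  by rewrite lee_fin mle// ge_min lexx orbT.
rewrite -EFinD lee_fin -mulr2n -[leLHS]mulr_natl.
rewrite (_ : - c * N%:R = (m - c) * N%:R + - m * N%:R)%R; last by ring.
rewrite expRD ler_pM2r ?expR_gt0// -[leLHS](@lnK R) ?posrE// ler_expR.
rewrite -ler_pdivrMl//.
by near: N; exact: nbhs_infty_ger.
Unshelve. all: by end_near. Qed.

Lemma ereal_inf_oppe_le (R : realType) (a b : \bar R) :
  (forall c : R, b < c%:E -> (- c)%:E <= a) -> - b <= a.
Proof.
move=> h; rewrite leNgt; apply/negP; rewrite lteNr => /ereal_between[c bc ca].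
by have := h _ bc; rewrite leNgt EFinN lteNr ca.
Qed.

(** At the critical level I x = L, the points of the segment from x to x0 have
strictly smaller rate, and those close to x are in G. *)
Lemma exists_subcritical (R : realType) (I : R -> \bar R) (G : set R)
    (x0 x L : R) :
  convex_efunction I -> I x0 = 0 -> (0 < L)%R -> open G -> G x ->
  I x <= L%:E -> exists y, [/\ G y, I y < L%:E & I y <= I x].
Proof.
move=> cvxI Ix0 L0 oG Gx; rewrite le_eqVlt => /orP[/eqP IxL|IxL]; last by exists x.
have [y [Gy yL]] : exists y, G y /\ I y < L%:E; last first.
  by exists y; split => //; rewrite IxL ltW.
have ct : (t * x + (1 - t) * x0)%R @[t --> (1%R : R)] --> x.
  rewrite -[X in _ --> X](_ : 1 * x + (1 - 1) * x0 = x)%R; last by ring.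
  apply: (@cvgD R R^o); apply: (@cvgMl R); first exact: cvg_id.
  apply: (@cvgB R R^o); [exact: cvg_cst|exact: cvg_id].
have Gt := cvg_at_left_filter ct (open_nbhs_nbhs (conj oG Gx)).
near (1%R : R)^'- => t.
have t0 : (0 <= t)%R by near: t; exact: nbhs_left_ge.
have t1 : (t < 1)%R by near: t; exact: nbhs_left_lt.
exists (t * x + (1 - t) * x0)%R; split; first by near: t.
apply: le_lt_trans (convex_segment_zero _ cvxI Ix0 _) _; first by rewrite t0 ltW.
by rewrite IxL -EFinM lte_fin gtr_pMl.
Unshelve. all: by end_near. Qed.

(** It suffices to bound from below the mass of a rational interval around a point
of G where I is below ln 2; [exists_subcritical] provides such a point with rate
at most that of any given point of finite truncated rate. *)
Lemma empirical_lower_bound (R : realType) (I : R -> \bar R)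
    (x : forall N : nat, 'I_(2 ^ N) -> R) (x0 : R) :
  convex_efunction I -> I x0 = 0 ->
  (forall p q c : rat,
    (exists2 y, `]ratr p, ratr q[%classic y & I y < (Num.min (ratr c) (ln 2))%:E) ->
    \forall N \near \oo, (expR (- ratr c * N%:R))%:E
      <= empirical_measure (x N) `]ratr p, ratr q[%classic) ->
  forall G : set R, open G ->
    - ereal_inf [set (if I y <= (ln 2)%:E then I y else +oo) | y in G]
    <= limn_einf (fun N => (N%:R^-1)%:E * lne (empirical_measure (x N) G)).
Proof.
move=> cvxI Ix0 growth G oG.
apply: ereal_inf_oppe_le => c /ereal_inf_lt[_ [y Gy <-]].
case: ifPn => // Iy2 Iyc.
have ln2 : (0 < ln 2 :> R)%R by rewrite ln_gt0// ltr1n.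
have [z [Gz Iz2 Izy]] := exists_subcritical cvxI Ix0 ln2 oG Gy Iy2.
have : I z < (Num.min c (ln 2))%:E.
  by rewrite EFin_min lt_min Iz2 (le_lt_trans Izy).
move=> /ereal_between[d Izd]; rewrite lte_fin => /rat_in_itvoo[k].
rewrite in_itv/= lt_min => /and3P[dk kc k2].
have [e /= e0 eG] : exists2 e : R, (0 < e)%R & ball z e `<=` G.
  by have /nbhs_ballP := open_nbhs_nbhs (conj oG Gz).
have /rat_in_itvoo[p] : (z - e < z)%R by rewrite ltrBlDr ltrDl.
rewrite in_itv/= => /andP[ep pz].
have /rat_in_itvoo[q] : (z < z + e)%R by rewrite ltrDl.
rewrite in_itv/= => /andP[zq qe].
have pqG : `]ratr p, ratr q[%classic `<=` G.
  move=> u /=; rewrite in_itv/= => /andP[pu uq]; apply: eG.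
  rewrite /ball/= ltr_distlC; lra.
have gr : \forall N \near \oo, (expR (- ratr k * N%:R))%:E
      <= empirical_measure (x N) `]ratr p, ratr q[%classic.
  apply: growth; exists z; first by rewrite /= in_itv/= pz zq.
  by apply: lt_trans Izd _; rewrite lte_fin lt_min dk (lt_trans dk).
apply: limn_einf_ge_near.
near=> N; have N0 : (0 < N)%N by near: N; exact: nbhs_infty_gt.
rewrite ge_rate_lne//.
apply: (@le_trans _ _ (expR (- ratr k * N%:R))%:E).
  by rewrite lee_fin ler_expR ler_wpM2r// lerN2 ltW.
apply: (@le_trans _ _ (empirical_measure (x N) `]ratr p, ratr q[%classic)).
  by near: N.
by apply: le_measure; rewrite ?inE//; exact: open_measurable.
Unshelve. all: by end_near. Qed.


(** * The large deviation principle for empirical measures *)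

Theorem theorem2p1 (R : realType)
    (lam : nat -> probability R R) (lambda : probability R R)
    (I : R -> \bar R)
    (lam_cvg : weak_convergence lam lambda)
    (lam_ldp : large_deviation_principle lam I)
    (I_convex : convex_efunction I)
    (d : measure_display) (Omega : measurableType d)
    (P : probability Omega R)
    (xi : forall N : nat, 'I_(2 ^ N) -> {RV P >-> R})
    (xi_iid : forall N : nat, (1 <= N)%N -> iid (xi N) (lam N)) :
  {ae P, forall w : Omega,
    large_deviation_principle
      (fun N => empirical_measure (fun i : 'I_(2 ^ N) => xi N i w))
      (fun x : R => if I x <= (ln 2)%:E then I x else +oo)}.
Proof.
have [x0 Ix0] := rate_function_has_zero lam_cvg lam_ldp.
have [rateI _ _] := lam_ldp.
pose halfline (right : bool) (q : rat) : set R :=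
  if right then `[ratr q, +oo[%classic else `]-oo, ratr q]%classic.
have decay : {ae P, forall w, forall bqc : bool * rat * rat,
    let A := halfline bqc.1.1 bqc.1.2 in
    (exists2 c : R, (ratr bqc.2 < c)%R & forall y, A y -> c%:E <= I y) ->
    \forall N \near \oo, empirical_measure (fun i => xi N i w) A
      <= (expR (- ratr bqc.2 * N%:R))%:E}.
  apply: ae_forall_countable => -[[b q] c] /=.
  set A := halfline b q.
  have cA : closed A by rewrite /A /halfline; case: (b); exact: interval_closed.
  have [[c' cc' IA]|noc] := pselect (exists2 c' : R, (ratr c < c')%R
      & forall y, A y -> c'%:E <= I y); last by apply: aeW.
  have cmid : (ratr c < (ratr c + c') / 2 < c')%R by rewrite !midf_lt.
  case/andP: cmid => cm mc'.
  have := ae_empirical_decay xi_iid (closed_measurable cA) cm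
    (ldp_closed_decay lam_ldp cA IA mc').
  by apply: filterS => w + _.
have growth : {ae P, forall w, forall pqc : rat * rat * rat,
    let A := `]ratr pqc.1.1, ratr pqc.1.2[%classic in
    (exists2 y, A y & I y < (Num.min (ratr pqc.2) (ln 2))%:E) ->
    \forall N \near \oo, (expR (- ratr pqc.2 * N%:R))%:E
      <= empirical_measure (fun i => xi N i w) A}.
  apply: ae_forall_countable => -[[p q] c] /=.
  set A := `]ratr p, ratr q[%classic.
  have oA : open A by exact: itv_open.
  have [[y Ay]|noy] := pselect (exists2 y, A y
      & I y < (Num.min (ratr c) (ln 2))%:E); last by apply: aeW.
  move=> /ereal_between[k Iyk]; rewrite lte_fin lt_min => /andP[kc k2].
  have := ae_empirical_growth xi_iid (open_measurable oA) kc k2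
    (ldp_open_growth lam_ldp oA Ay Iyk).
  by apply: filterS => w + _.
apply: filterS2 decay growth => w decay growth; split.
- exact: rate_function_truncate.
- apply: (empirical_upper_bound rateI I_convex Ix0) => A q c.
  by move=> [->|->]; [exact: (decay (false, q, c))|exact: (decay (true, q, c))].
- apply: (empirical_lower_bound I_convex Ix0) => p q c.
  exact: (growth (p, q, c)).
Qed.
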